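(* Consider the DG+FL+SL method described in the context, for flow driven by boundary conditions only (no wells). Let $0\le s_\ast\le s^\ast\le 1$ be the constants used in the flux and slope limiters, and let $(S_{n+1})_{n}$, $n=0,\dots,N_\tau-1$, be the sequence of discrete saturations produced by the method. Assume that the initial saturation $S_0$ is bounded below by $s_\ast$ and above by $s^\ast$. Then, for every $n$, $$s_\ast\le S_{n+1}(\mathbf{x})\le s^\ast,\qquad \forall\,\mathbf{x}\in\Omega .$$
   Context: **Setting.** $\Omega\subset\mathbb{R}^2$ is decomposed into a non-degenerate partition $\mathcal{E}_h$ of triangular or rectangular elements of maximum diameter $h$. $\Gamma_h^i$ is the set of interior edges. For each $e\in\Gamma_h^i$ a unit normal $\mathbf{n}_e$ is fixed, and $E^+,E^-$ are the two elements sharing $e$, with $\mathbf{n}_e$ directed from $E^+$ to $E^-$. Set $[\xi]=\xi|_{E^+}-\xi|_{E^-}$ and $\{\xi\}=\frac12(\xi|_{E^+}+\xi|_{E^-})$. On boundary edges jump and average equal the trace, and $\mathbf{n}_e=\mathbf{n}$ is the outward normal. $\mathcal{D}(\mathcal{E}_h)=\{\xi\in L^2(\Omega):\xi|_E\in\mathbb{P}_1(E)\ \forall E\in\mathcal{E}_h\}$, where $\mathbb{P}_1(E)$ is the space of linear polynomials on $E$. The time interval $[0,T]$ is divided into $N_\tau$ equal subintervals of length $\tau$. The boundary is split into disjoint parts in two ways: $\partial\Omega=\Gamma^{\mathrm{D},p}\cup\Gamma^{\mathrm{N},p}=\Gamma^{\mathrm{D},s}\cup\Gamma^{\mathrm{N},s}\cup\Gamma^{\mathrm{out}}$,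 with boundary data $g^p,j^p,g^s,j^s$. The given data are: porosity $\phi>0$ (treated as a constant), permeability $K$, gravity vector $\mathbf{g}$, densities $\rho_w,\rho_\ell$, mobilities $\lambda_\alpha(S)=k_{r\alpha}(S)/\mu_\alpha$ ($\alpha=w,\ell$), where $k_{r\alpha}$ are given relative permeability functions of the wetting saturation and $\mu_\alpha$ are phase viscosities, capillary pressure function $P_c(S)$, and penalty parameter $\sigma>0$. There are no wells: all source/sink terms vanish. **DG step.** $S_0\in\mathcal{D}(\mathcal{E}_h)$ is the $L^2$ projection of the initial condition $s_0$. Given $(P_n,S_n)\in\mathcal{D}(\mathcal{E}_h)^2$, set $\mathbf{v}_w^n=-K(\nabla P_n-\rho_w\mathbf{g})$ and $\mathbf{v}_\ell^n=-K(\nabla P_n+\nabla P_c(S_n)-\rho_\ell\mathbf{g})$. The upwind value $\xi^{\uparrow\mathbf{v}}|_e$ equals $\xi|_{E^+}$ if $\{\mathbf{v}\}\cdot\mathbf{n}_e>0$ and $\xi|_{E^-}$ if $\{\mathbf{v}\}\cdot\mathbf{n}_e\le0$. Let $(P_{n+1},\widetilde S_{n+1})\in\mathcal{D}(\mathcal{E}_h)^2$ be the computed solution of the following equations, for all $\xi\in\mathcal{D}(\mathcal{E}_h)$: $$\frac1\tau\int_\Omega\phi(1-\widetilde S_{n+1})\xi+\sum_{E}\int_E\lambda_\ell(\widetilde S_{n+1})K(\nabla P_{n+1}+\nabla P_c(\widetilde S_{n+1})-\rho_\ell\mathbf{g})\cdot\nabla\xi$$ $$-\sum_{e\in\Gamma_h^i}\int_e(\lambda_\ell(\widetilde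 S_{n+1}))^{\uparrow\mathbf{v}_\ell^n}\{K(\nabla P_{n+1}+\nabla P_c(\widetilde S_{n+1})-\rho_\ell\mathbf{g})\cdot\mathbf{n}_e\}[\xi]-\sum_{e\in\Gamma^{\mathrm{D},p}}\int_e\lambda_\ell(\widetilde S_{n+1})K(\nabla P_{n+1}+\nabla P_c(\widetilde S_{n+1})-\rho_\ell\mathbf{g})\cdot\mathbf{n}_e\,\xi$$ $$+\sum_{e\in\Gamma_h^i\cup\Gamma^{\mathrm{D},p}}\frac\sigma h\int_e[P_{n+1}][\xi]=\frac1\tau\int_\Omega\phi(1-S_n)\xi+\frac\sigma h\int_{\Gamma^{\mathrm{D},p}}g^p\xi+\int_{\Gamma^{\mathrm{N},p}}j^p\xi,$$ $$\frac1\tau\int_\Omega\phi\widetilde S_{n+1}\xi+\sum_E\int_E\lambda_w(\widetilde S_{n+1})K(\nabla P_{n+1}-\rho_w\mathbf{g})\cdot\nabla\xi-\sum_{e\in\Gamma_h^i}\int_e(\lambda_w(\widetilde S_{n+1}))^{\uparrow\mathbf{v}_w^n}\{K(\nabla P_{n+1}-\rho_w\mathbf{g})\cdot\mathbf{n}_e\}[\xi]$$ $$-\sum_{e\in\Gamma^{\mathrm{D},s}}\int_e\lambda_w(g^s)K(\nabla P_{n+1}-\rho_w\mathbf{g})\cdot\mathbf{n}\,\xi-\sum_{e\in\Gamma^{\mathrm{out}}}\int_e\lambda_w(\widetilde S_{n+1})K(\nabla P_{n+1}-\rho_w\mathbf{g})\cdot\mathbf{n}_e\,\xi+\sum_{e\in\Gamma_h^i\cup\Gamma^{\mathrm{D},s}}\frac\sigma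 h\int_e[\widetilde S_{n+1}][\xi]$$ $$=\frac1\tau\int_\Omega\phi S_n\xi+\frac\sigma h\int_{\Gamma^{\mathrm{D},s}}g^s\xi+\int_{\Gamma^{\mathrm{N},s}}j^s\xi .$$ ($\sigma$ is constant on interior edges and 10 times larger on Dirichlet edges.) **Flux function.** For each element $E$ with unit outward normal $\mathbf{n}_E$: - if $e=\partial E\cap\partial E'$: $\mathcal{H}_{n+1,E}(e)=-\int_e(\lambda_w(\widetilde S_{n+1}))^{\uparrow\mathbf{v}_w^n}\{K(\nabla P_{n+1}-\rho_w\mathbf{g})\cdot\mathbf{n}_E\}+\frac\sigma h\int_e(\widetilde S_{n+1}|_E-\widetilde S_{n+1}|_{E'})$; - if $e\subset\partial E\cap\Gamma^{\mathrm{D},s}$: $\mathcal{H}_{n+1,E}(e)=-\int_e\lambda_w(g^s)K(\nabla P_{n+1}-\rho_w\mathbf{g})\cdot\mathbf{n}_E+\frac\sigma h\int_e(\widetilde S_{n+1}-g^s)$; - if $e\subset\partial E\cap\Gamma^{\mathrm{N},s}$: $\mathcal{H}_{n+1,E}(e)=\int_e j^s$; - if $e\subset\partial E\cap\Gamma^{\mathrm{out}}$: $\mathcal{H}_{n+1,E}(e)=\int_e\lambda_w(\widetilde S_{n+1})K(\nabla P_{n+1}-\rho_w\mathbf{g})\cdot\mathbf{n}_E$. For interior faces, $\mathcal{H}_{n+1,E}(e)=-\mathcal{H}_{n+1,E'}(e)$. **Averaging algorithm $\mathcal{L}_{\mathrm{avg}}$.** Cell averages are $\overline{S_{n,E}}=\frac1{|E|}\int_E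 S_n$. Initialize $\bar S_E^{(0)}=\overline{S_{n,E}}$ and $\mathcal{H}_E^{(0)}=\mathcal{H}_{n+1,E}$ for all $E$. For $k\ge1$ (with no wells): 1. $P_E^+=\tau\sum_{e\subset\partial E}\max(0,-\mathcal{H}_E^{(k-1)}(e))$ and $P_E^-=\tau\sum_{e\subset\partial E}\min(0,-\mathcal{H}_E^{(k-1)}(e))$. 2. $Q_E^+=|E|(\phi s^\ast-\phi\bar S_E^{(k-1)})$ and $Q_E^-=|E|(\phi s_\ast-\phi\bar S_E^{(k-1)})$. 3. For an interior face $e=\partial E\cap\partial E'$: $\alpha_E^{(k-1)}(e)=\min(\min(1,Q_E^+/P_E^+),\min(1,Q_{E'}^-/P_{E'}^-))$ if $\mathcal{H}_E^{(k-1)}(e)<0$, and $\alpha_E^{(k-1)}(e)=\min(\min(1,Q_E^-/P_E^-),\min(1,Q_{E'}^+/P_{E'}^+))$ if $\mathcal{H}_E^{(k-1)}(e)>0$. For a boundary face: $\alpha_E^{(k-1)}(e)=\min(1,Q_E^+/P_E^+)$ if $\mathcal{H}_E^{(k-1)}(e)<0$, and $\min(1,Q_E^-/P_E^-)$ if $\mathcal{H}_E^{(k-1)}(e)>0$. (If $\mathcal{H}_E^{(k-1)}(e)=0$ the value of $\alpha$ is immaterial, since it only enters through products with $\mathcal{H}_E^{(k-1)}(e)$.) 4. $\bar S_E^{(k)}=\bar S_E^{(k-1)}-\frac{\tau}{\phi|E|}\sum_{e\subset\partial E}\alpha_E^{(k-1)}(e)\mathcal{H}_E^{(k-1)}(e)$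 and $\mathcal{H}_E^{(k)}(e)=(1-\alpha_E^{(k-1)}(e))\mathcal{H}_E^{(k-1)}(e)$. 5. Let $\epsilon_1,\epsilon_2>0$ be fixed tolerances, and let $|\cdot|$ of a flux function on $E$ denote the maximum of absolute values over the faces of $E$. If $\max_E|\mathcal{H}_E^{(k)}|<\epsilon_1$ or $\max_E|\mathcal{H}_E^{(k)}-\mathcal{H}_E^{(k-1)}|<\epsilon_2$ for $k\ge2$, stop and return $\bar S_{n+1}^{\mathrm{FL}}|_E=\bar S_E^{(k)}$ for all $E$; otherwise increase $k$ by one and return to step 1. **Flux limiter.** $S_{n+1}^{\mathrm{FL}}(\mathbf{x})=\widetilde S_{n+1}(\mathbf{x})-\frac1{|E|}\int_E\widetilde S_{n+1}+\bar S_{n+1}^{\mathrm{FL}}|_E$ for $\mathbf{x}\in E$. **Slope limiter.** Write $\bar S^{\mathrm{FL}}_{n+1,E}$ for the cell average of $S^{\mathrm{FL}}_{n+1}$ on $E$, $\mathbf{c}_E$ for the centroid of $E$ and $\mathbf{v}_{E,i}$ for its vertices. An element $E$ is marked if $S_{n+1}^{\mathrm{FL}}(\mathbf{x})>s^\ast$ or $S_{n+1}^{\mathrm{FL}}(\mathbf{x})<s_\ast$ for some $\mathbf{x}\in E$. On unmarked elements $S_{n+1}=S_{n+1}^{\mathrm{FL}}$. On marked elements $$S_{n+1}(\mathbf{x})=\bar S^{\mathrm{FL}}_{n+1,E}+\beta_E\nabla S_{n+1}^{\mathrm{FL}}\cdot(\mathbf{x}-\mathbf{c}_E),\quad\mathbf{x}\in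 E.$$ Here $S_*^{E,i}$ and $S^*_{E,i}$ are respectively the minimum and maximum of $\bar S^{\mathrm{FL}}_{n+1,E'}$ over all elements $E'$ (including $E$) containing the vertex $\mathbf{v}_{E,i}$, and $\beta_E=\min_i\beta_{E,i}$ with $$\beta_{E,i}=\begin{cases}\dfrac{S^*_{E,i}-\bar S^{\mathrm{FL}}_{n+1,E}}{S^{\mathrm{FL}}_{n+1}(\mathbf{v}_{E,i})-\bar S^{\mathrm{FL}}_{n+1,E}}&\text{if }S^{\mathrm{FL}}_{n+1}(\mathbf{v}_{E,i})>S^*_{E,i},\\[2mm]1&\text{if }S_*^{E,i}\le S^{\mathrm{FL}}_{n+1}(\mathbf{v}_{E,i})\le S^*_{E,i},\\[1mm]\dfrac{S_*^{E,i}-\bar S^{\mathrm{FL}}_{n+1,E}}{S^{\mathrm{FL}}_{n+1}(\mathbf{v}_{E,i})-\bar S^{\mathrm{FL}}_{n+1,E}}&\text{if }S^{\mathrm{FL}}_{n+1}(\mathbf{v}_{E,i})<S_*^{E,i}.\end{cases}$$ (Vertex values on $E$ are values of the restriction to $E$.) **DG+FL+SL method.** Compute $S_0$. For $n=0,\dots,N_\tau-1$: perform the DG step to get $(P_{n+1},\widetilde S_{n+1})$, apply the flux limiter to get $S^{\mathrm{FL}}_{n+1}$, then apply the slope limiter to get $S_{n+1}$, which is used in the next step. *)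

(* Defs.v *)
From HB Require Import structures.
From mathcomp Require Import all_boot all_order all_algebra.
From mathcomp Require Import all_classical all_reals all_analysis.

Set Implicit Arguments.
Unset Strict Implicit.
Unset Printing Implicit Defensive.

Import Order.TTheory GRing.Theory Num.Theory.
Import numFieldNormedType.Exports.
Local Open Scope classical_set_scope.
Local Open Scope ring_scope.

(* Points and vectors of the plane are pairs.  The norm and the order carried *)
(* by R * R in the library are not the Euclidean ones, hence [dot], [enorm].  *)
Notation plane R := (R * R)%type.

Notation area_measure := (lebesgue_measure \x lebesgue_measure)%E (only parsing).

Section Plane.
Context {R : realType}.
Implicit Types (u v a b x : plane R) (A : set (plane R)) (vs : seq (plane R)).

Definition dot u v : R := u.1 * v.1 + u.2 * v.2.

Definition enorm u : R := Num.sqrt (dot u u).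

Definition matvec (K : 'M[R]_2) v : plane R :=
  (K 0 0 * v.1 + K 0 1 * v.2, K 1 0 * v.1 + K 1 1 * v.2).

Definition grad (f : plane R -> R) x : plane R :=
  (derive1 (fun t => f (t, x.2)) x.1, derive1 (fun t => f (x.1, t)) x.2).

Definition is_P1 (f : plane R -> R) : Prop :=
  exists (c : R) (g : plane R), forall x, f x = c + dot g x.

Definition diam A : R :=
  sup [set r | exists x y, [/\ A x, A y & r = enorm (x - y)]].

Definition edisc x (r : R) : set (plane R) := [set y | enorm (y - x) <= r].

Definition frontier A : set (plane R) := closure A `\` interior A.

Definition segm a b : set (plane R) :=
  [set x | exists2 t : R, 0 <= t <= 1 & x = a + t *: (b - a)].

Definition osegm a b : set (plane R) :=
  [set x | exists2 t : R, 0 < t < 1 & x = a + t *: (b - a)].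

Definition hull vs : set (plane R) :=
  [set x | exists w : nat -> R,
    [/\ forall i, 0 <= w i,
        \sum_(i < size vs) w i = 1
      & x = \sum_(i < size vs) w i *: nth (0, 0) vs i]].

Definition is_triangle vs : Prop :=
  exists a b c, vs = [:: a; b; c] /\
    (b - a).1 * (c - a).2 - (b - a).2 * (c - a).1 != 0.

Definition is_rectangle vs : Prop :=
  exists a b c d, [/\ vs = [:: a; b; c; d],
    c - b = d - a, dot (b - a) (d - a) = 0, a != b & a != d].

Definition int_area A (f : plane R -> R) : R :=
  \int[area_measure]_(x in A) f x.

Definition int_segm a b (f : plane R -> R) : R :=
  enorm (b - a) * \int[lebesgue_measure]_(t in `[0, 1]) f (a + t *: (b - a)).

End Plane.

(* Elements are the closed convex hulls of their vertices.  An edge e has     *)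
(* [edge_plus e] = E^+; [edge_minus e] is [Some E^-] on an interior edge and  *)
(* [None] on a boundary edge.  Hanging nodes are allowed: an interior edge is *)
(* the whole interface of its two elements.                                   *)
Record mesh (R : realType) (Omega : set (plane R)) := Mesh {
  elt : finType ;
  vertices : elt -> seq (plane R) ;
  cell (E : elt) : set (plane R) := hull (vertices E) ;
  edge : finType ;
  edge_a : edge -> plane R ;
  edge_b : edge -> plane R ;
  edge_plus : edge -> elt ;
  edge_minus : edge -> option elt ;
  normal : edge -> plane R ;
  face (E : elt) (e : edge) : bool :=
    (edge_plus e == E) || (edge_minus e == Some E) ;
  cell_shape : forall E, is_triangle (vertices E) \/ is_rectangle (vertices E) ;
  cell_cover : closure Omega = \bigcup_(E in [set: elt]) cell E ;
  cell_sub : forall E, interior (cell E) `<=` Omega ;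
  cell_disjoint : forall E E', E != E' ->
    interior (cell E) `&` interior (cell E') = set0 ;
  nondegeneracy : R ;
  cell_nondegenerate : forall E, exists x r,
    [/\ 0 < r, edisc x r `<=` cell E & diam (cell E) <= nondegeneracy * r] ;
  edge_ends : forall e, edge_a e != edge_b e ;
  edge_interior : forall e E', edge_minus e = Some E' ->
    [/\ E' != edge_plus e,
        segm (edge_a e) (edge_b e) =
          frontier (cell (edge_plus e)) `&` frontier (cell E')
      & osegm (edge_a e) (edge_b e) `<=` interior Omega] ;
  edge_boundary : forall e, edge_minus e = None ->
    segm (edge_a e) (edge_b e) `<=`
      frontier (cell (edge_plus e)) `&` frontier Omega ;
  face_cover : forall E, frontier (cell E) =
    \bigcup_(e in [set e | face E e]) segm (edge_a e) (edge_b e) ;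
  face_disjoint : forall E e e', face E e -> face E e' -> e != e' ->
    osegm (edge_a e) (edge_b e) `&` osegm (edge_a e') (edge_b e') = set0 ;
  normal_unit : forall e, enorm (normal e) = 1 ;
  normal_orth : forall e, dot (normal e) (edge_b e - edge_a e) = 0 ;
  normal_outward : forall e x, cell (edge_plus e) x ->
    dot (normal e) (x - edge_a e) <= 0
}.

Inductive pressure_bc := PDirichlet | PNeumann.
Inductive saturation_bc := SDirichlet | SNeumann | SOutflow.

(* The permeability is a tensor field given element by element, so that it    *)
(* has a trace from each side of an edge.  The values of [bc_p] and [bc_s] on *)
(* interior edges are never used.                                             *)
Record flow_data (R : realType) (Omega : set (plane R)) (M : mesh Omega) :=
  FlowData {
  porosity : R ;
  perm : elt M -> plane R -> 'M[R]_2 ;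
  gravity : plane R ;
  rho_w : R ;
  rho_l : R ;
  kr_w : R -> R ;
  kr_l : R -> R ;
  visc_w : R ;
  visc_l : R ;
  Pc : R -> R ;
  sigma : R ;
  bc_p : edge M -> pressure_bc ;
  bc_s : edge M -> saturation_bc ;
  g_p : plane R -> R ;
  j_p : plane R -> R ;
  g_s : plane R -> R ;
  j_s : plane R -> R
}.

Section DG.
Context {R : realType} {Omega : set (plane R)} {M : mesh Omega}.

(* A discontinuous function is given by its restrictions to the elements,     *)
(* each extended to the plane; this provides the two traces on an edge.       *)
Definition broken := elt M -> plane R -> R.

Definition in_D (xi : broken) : Prop := forall E, is_P1 (xi E).

Definition meshsize : R := \big[Num.max/0]_(E : elt M) diam (cell E).

Definition area (E : elt M) : R := fine (area_measure (cell E)).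

Definition mean (E : elt M) (f : plane R -> R) : R :=
  int_area (cell E) f / area E.

Definition centroid (E : elt M) : plane R :=
  (mean E (fun x => x.1), mean E (fun x => x.2)).

Definition int_edge (e : edge M) (f : plane R -> R) : R :=
  int_segm (edge_a e) (edge_b e) f.

Definition interior_edge (e : edge M) : bool := isSome (edge_minus e).

Definition jump (e : edge M) (xi : broken) (x : plane R) : R :=
  if edge_minus e is Some E' then xi (edge_plus e) x - xi E' x
  else xi (edge_plus e) x.

Definition average (V : lmodType R) (e : edge M) (xi : elt M -> plane R -> V)
    (x : plane R) : V :=
  if edge_minus e is Some E' then 2^-1 *: (xi (edge_plus e) x + xi E' x)
  else xi (edge_plus e) x.

(* Only used on interior edges. *)
Definition upwind (e : edge M) (v : elt M -> plane R -> plane R)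
    (xi : broken) (x : plane R) : R :=
  if 0 < dot (average e v x) (normal e) then xi (edge_plus e) x
  else xi (odflt (edge_plus e) (edge_minus e)) x.

(* For e a face of E: the element on the other side of e, and the unit normal *)
(* to e outward to E.                                                         *)
Definition neighbor (E : elt M) (e : edge M) : option (elt M) :=
  if edge_plus e == E then edge_minus e else Some (edge_plus e).

Definition outward (E : elt M) (e : edge M) : plane R :=
  if edge_plus e == E then normal e else - normal e.

Variable D : flow_data M.

Definition lambda_w (s : R) : R := kr_w D s / visc_w D.
Definition lambda_l (s : R) : R := kr_l D s / visc_l D.

Definition dirichlet_p (e : edge M) : bool :=
  ~~ interior_edge e && (if bc_p D e is PDirichlet then true else false).
Definition neumann_p (e : edge M) : bool :=
  ~~ interior_edge e && (if bc_p D e is PNeumann then true else false).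
Definition dirichlet_s (e : edge M) : bool :=
  ~~ interior_edge e && (if bc_s D e is SDirichlet then true else false).
Definition neumann_s (e : edge M) : bool :=
  ~~ interior_edge e && (if bc_s D e is SNeumann then true else false).
Definition outflow_s (e : edge M) : bool :=
  ~~ interior_edge e && (if bc_s D e is SOutflow then true else false).

Definition penalty (e : edge M) : R :=
  (if interior_edge e then sigma D else 10 * sigma D) / meshsize.

Definition Kgrad_w (P : broken) (E : elt M) (x : plane R) : plane R :=
  matvec (perm D E x) (grad (P E) x - rho_w D *: gravity D).

Definition Kgrad_l (P S : broken) (E : elt M) (x : plane R) : plane R :=
  matvec (perm D E x)
    (grad (P E) x + grad (fun y => Pc D (S E y)) x - rho_l D *: gravity D).

Definition vel_w (P : broken) (E : elt M) (x : plane R) : plane R :=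
  - Kgrad_w P E x.

Definition vel_l (P S : broken) (E : elt M) (x : plane R) : plane R :=
  - Kgrad_l P S E x.

Section Step.
Variable tau : R.
Variables Pn Sn P S : broken.

Definition dg_nonwetting : Prop := forall xi : broken, in_D xi ->
  tau^-1 * \sum_(E : elt M)
      int_area (cell E) (fun x => porosity D * (1 - S E x) * xi E x)
  + \sum_(E : elt M) int_area (cell E) (fun x =>
      lambda_l (S E x) * dot (Kgrad_l P S E x) (grad (xi E) x))
  - \sum_(e : edge M | interior_edge e) int_edge e (fun x =>
      upwind e (vel_l Pn Sn) (fun E y => lambda_l (S E y)) x
      * average e (fun E y => dot (Kgrad_l P S E y) (normal e)) x
      * jump e xi x)
  - \sum_(e : edge M | dirichlet_p e) int_edge e (fun x =>
      lambda_l (S (edge_plus e) x)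
      * dot (Kgrad_l P S (edge_plus e) x) (normal e) * xi (edge_plus e) x)
  + \sum_(e : edge M | interior_edge e || dirichlet_p e)
      penalty e * int_edge e (fun x => jump e P x * jump e xi x)
  = tau^-1 * \sum_(E : elt M)
      int_area (cell E) (fun x => porosity D * (1 - Sn E x) * xi E x)
  + \sum_(e : edge M | dirichlet_p e)
      penalty e * int_edge e (fun x => g_p D x * xi (edge_plus e) x)
  + \sum_(e : edge M | neumann_p e)
      int_edge e (fun x => j_p D x * xi (edge_plus e) x).

Definition dg_wetting : Prop := forall xi : broken, in_D xi ->
  tau^-1 * \sum_(E : elt M)
      int_area (cell E) (fun x => porosity D * S E x * xi E x)
  + \sum_(E : elt M) int_area (cell E) (fun x =>
      lambda_w (S E x) * dot (Kgrad_w P E x) (grad (xi E) x))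
  - \sum_(e : edge M | interior_edge e) int_edge e (fun x =>
      upwind e (vel_w Pn) (fun E y => lambda_w (S E y)) x
      * average e (fun E y => dot (Kgrad_w P E y) (normal e)) x
      * jump e xi x)
  - \sum_(e : edge M | dirichlet_s e) int_edge e (fun x =>
      lambda_w (g_s D x)
      * dot (Kgrad_w P (edge_plus e) x) (normal e) * xi (edge_plus e) x)
  - \sum_(e : edge M | outflow_s e) int_edge e (fun x =>
      lambda_w (S (edge_plus e) x)
      * dot (Kgrad_w P (edge_plus e) x) (normal e) * xi (edge_plus e) x)
  + \sum_(e : edge M | interior_edge e || dirichlet_s e)
      penalty e * int_edge e (fun x => jump e S x * jump e xi x)
  = tau^-1 * \sum_(E : elt M)
      int_area (cell E) (fun x => porosity D * Sn E x * xi E x)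
  + \sum_(e : edge M | dirichlet_s e)
      penalty e * int_edge e (fun x => g_s D x * xi (edge_plus e) x)
  + \sum_(e : edge M | neumann_s e)
      int_edge e (fun x => j_s D x * xi (edge_plus e) x).

Definition dg_step : Prop := [/\ in_D P, in_D S, dg_nonwetting & dg_wetting].

Definition flux (E : elt M) (e : edge M) : R :=
  if neighbor E e is Some E' then
    - int_edge e (fun x =>
        upwind e (vel_w Pn) (fun F y => lambda_w (S F y)) x
        * average e (fun F y => dot (Kgrad_w P F y) (outward E e)) x)
    + penalty e * int_edge e (fun x => S E x - S E' x)
  else match bc_s D e with
  | SDirichlet =>
      - int_edge e (fun x =>
          lambda_w (g_s D x) * dot (Kgrad_w P E x) (outward E e))
      + penalty e * int_edge e (fun x => S E x - g_s D x)
  | SNeumann => int_edge e (fun x => j_s D x)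
  | SOutflow =>
      int_edge e (fun x =>
        lambda_w (S E x) * dot (Kgrad_w P E x) (outward E e))
  end.

End Step.

Section FluxLimiter.
Variables (tau smin smax eps1 eps2 : R).
Implicit Types (sbar : elt M -> R) (H : elt M -> edge M -> R).

Definition Pplus H (E : elt M) : R :=
  tau * \sum_(e : edge M | face E e) Num.max 0 (- H E e).
Definition Pminus H (E : elt M) : R :=
  tau * \sum_(e : edge M | face E e) Num.min 0 (- H E e).
Definition Qplus sbar (E : elt M) : R :=
  area E * (porosity D * smax - porosity D * sbar E).
Definition Qminus sbar (E : elt M) : R :=
  area E * (porosity D * smin - porosity D * sbar E).

Definition limit_plus sbar H (E : elt M) : R :=
  Num.min 1 (Qplus sbar E / Pplus H E).
Definition limit_minus sbar H (E : elt M) : R :=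
  Num.min 1 (Qminus sbar E / Pminus H E).

(* The value where H vanishes is immaterial. *)
Definition alpha sbar H (E : elt M) (e : edge M) : R :=
  if H E e < 0 then
    (if neighbor E e is Some E' then
       Num.min (limit_plus sbar H E) (limit_minus sbar H E')
     else limit_plus sbar H E)
  else if 0 < H E e then
    (if neighbor E e is Some E' then
       Num.min (limit_minus sbar H E) (limit_plus sbar H E')
     else limit_minus sbar H E)
  else 1.

Definition avg_update (st : (elt M -> R) * (elt M -> edge M -> R)) :=
  let: (sbar, H) := st in
  ((fun E => sbar E - tau / (porosity D * area E)
       * \sum_(e : edge M | face E e) alpha sbar H E e * H E e),
   (fun E e => (1 - alpha sbar H E e) * H E e)).

Definition flux_norm H : R :=
  \big[Num.max/0]_(E : elt M) \big[Num.max/0]_(e : edge M | face E e) `|H E e|.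

Definition avg_iter sbar0 H0 (k : nat) := iter k avg_update (sbar0, H0).

Definition avg_stop sbar0 H0 (k : nat) : bool :=
  (flux_norm (avg_iter sbar0 H0 k).2 < eps1)
  || ((2 <= k)%N &&
      (flux_norm (fun E e => (avg_iter sbar0 H0 k).2 E e
                             - (avg_iter sbar0 H0 k.-1).2 E e) < eps2)).

Definition avg_returns sbar0 H0 sbar : Prop :=
  exists k : nat, [/\ (1 <= k)%N, avg_stop sbar0 H0 k,
    (forall j : nat, (1 <= j < k)%N -> ~~ avg_stop sbar0 H0 j)
    & forall E, sbar E = (avg_iter sbar0 H0 k).1 E].

Definition flux_limited (S : broken) sbar : broken :=
  fun E x => S E x - mean E (S E) + sbar E.

End FluxLimiter.

Section SlopeLimiter.
Variables (smin smax : R) (S : broken).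

Definition vmin (E : elt M) (v : plane R) : R :=
  \big[Num.min/mean E (S E)]_(E' : elt M | `[< cell E' v >]) mean E' (S E').
Definition vmax (E : elt M) (v : plane R) : R :=
  \big[Num.max/mean E (S E)]_(E' : elt M | `[< cell E' v >]) mean E' (S E').

Definition beta_vertex (E : elt M) (v : plane R) : R :=
  if vmax E v < S E v then (vmax E v - mean E (S E)) / (S E v - mean E (S E))
  else if S E v < vmin E v then
    (vmin E v - mean E (S E)) / (S E v - mean E (S E))
  else 1.

(* The minimum over the (nonempty) list of vertices. *)
Definition beta (E : elt M) : R :=
  \big[Num.min/beta_vertex E (head (0, 0) (vertices E))]_(v <- vertices E)
    beta_vertex E v.

Definition marked (E : elt M) : Prop :=
  exists2 x, cell E x & (smax < S E x) || (S E x < smin).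

Definition slope_limited : broken := fun E x =>
  if `[< marked E >] then
    mean E (S E) + beta E * dot (grad (S E) x) (x - centroid E)
  else S E x.

End SlopeLimiter.

Definition is_L2_projection (s0 : plane R -> R) (S0 : broken) : Prop :=
  [/\ measurable_fun Omega s0,
      (area_measure).-integrable Omega (fun x => (s0 x ^+ 2)%:E),
      in_D S0
    & forall xi : broken, in_D xi ->
        \sum_(E : elt M) int_area (cell E `&` Omega)
          (fun x => (S0 E x - s0 x) * xi E x) = 0].

Definition DG_FL_SL (tau : R) (N : nat) (smin smax eps1 eps2 : R)
    (s0 : plane R -> R) (P S : nat -> broken) : Prop :=
  [/\ in_D (P 0%N), is_L2_projection s0 (S 0%N)
    & forall n : nat, (n < N)%N ->
        exists (St : broken) (sbar : elt M -> R),
        [/\ dg_step tau (P n) (S n) (P n.+1) St,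
            avg_returns tau smin smax eps1 eps2
              (fun E => mean E (S n E)) (flux (P n) (P n.+1) St) sbar
          & forall E x, S n.+1 E x =
              slope_limited smin smax (flux_limited St sbar) E x]].

End DG.

(* Main.v *)
Require Import Defs.
From HB Require Import structures.
From mathcomp Require Import all_boot all_order all_algebra.
From mathcomp Require Import all_classical all_reals all_analysis.
From mathcomp Require Import ring lra measurable_realfun.

Import Order.TTheory GRing.Theory Num.Theory.
Import numFieldNormedType.Exports.
Local Open Scope classical_set_scope.
Local Open Scope ring_scope.

Set Implicit Arguments.
Unset Strict Implicit.

(** Both limiters act cell by cell.  In one pass of the averaging algorithm,
    alpha <= Q^+/P^+ on the inflow faces of E (and alpha >= 0 on the others)
    lets at most the quantity Q^+ enter, which is exactly what raises the cell
    average to the upper bound; the lower bound is symmetric with Q^- and P^-.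
    Whatever the fluxes are, every iterate thus stays between the bounds, and
    shifting by a constant makes that iterate the mean of the flux-limited
    function.  The slope limiter keeps an affine function f affine with the
    same mean, and its value mean + beta (f(v) - mean) at a vertex v lies
    between the mean and f(v), or between the mean and the nearest extreme cell
    average around v when f(v) is beyond it; an affine function within the
    bounds at the vertices is so on their convex hull. *)

(** * Affine functions and convex hulls in the plane *)

Section Plane.
Context {R : realType}.
Implicit Types (a g u v x y : plane R) (f : plane R -> R).
Implicit Types (vs : seq (plane R)).

Lemma planeD x y : x + y = (x.1 + y.1, x.2 + y.2). Proof. by []. Qed.

Lemma planeN x : - x = (- x.1, - x.2). Proof. by []. Qed.

Lemma planeZ (k : R) x : k *: x = (k * x.1, k * x.2). Proof. by []. Qed.

Definition planeE := (planeD, planeN, planeZ).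

Lemma dotDr g x y : dot g (x + y) = dot g x + dot g y.
Proof. by rewrite planeE /dot /=; ring. Qed.

Lemma dotBr g x y : dot g (x - y) = dot g x - dot g y.
Proof. by rewrite !planeE /dot /=; ring. Qed.

Lemma dotZr g (k : R) x : dot g (k *: x) = k * dot g x.
Proof. by rewrite planeE /dot /=; ring. Qed.

Lemma dotZl (k : R) g x : dot (k *: g) x = k * dot g x.
Proof. by rewrite planeE /dot /=; ring. Qed.

Lemma dotNl g x : dot (- g) x = - dot g x.
Proof. by rewrite planeE /dot /=; ring. Qed.

Lemma dot0r g : dot g 0 = 0.
Proof. by rewrite -(scale0r g) dotZr mul0r. Qed.

(** Since the weights sum to 1, the constant term [c] is its own weighted sum; the linear part
    commutes with any combination. *)
Lemma P1_sum f n (w : nat -> R) (p : nat -> plane R) : is_P1 f ->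
  \sum_(i < n) w i = 1 ->
  f (\sum_(i < n) w i *: p i) = \sum_(i < n) w i * f (p i).
Proof.
move=> [c [g fE]] w1; rewrite fE.
have -> : dot g (\sum_(i < n) w i *: p i) = \sum_(i < n) w i * dot g (p i).
  elim: n {w1} => [|n IH]; first by rewrite !big_ord0 dot0r.
  by rewrite !big_ord_recr dotDr dotZr -IH.
rewrite -[c]mul1r -w1 mulr_suml -big_split /=.
by apply: eq_bigr => i _; rewrite fE -mulrDr.
Qed.

Lemma hull_P1_le f vs (m : R) : is_P1 f ->
  (forall v, v \in vs -> f v <= m) -> forall x, hull vs x -> f x <= m.
Proof.
move=> fP1 fm x [w [w0 w1 ->]]; rewrite P1_sum // -[m]mul1r -w1 mulr_suml.
by apply: ler_sum => i _; rewrite ler_wpM2l // fm // mem_nth.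
Qed.

Lemma is_P1N f : is_P1 f -> is_P1 (fun x => - f x).
Proof.
by move=> [c [g fE]]; exists (- c), (- g) => x; rewrite fE dotNl opprD.
Qed.

Lemma is_P1_fst : is_P1 (fun x => x.1).
Proof. by exists 0, (1, 0) => x; rewrite /dot /=; ring. Qed.

Lemma is_P1_snd : is_P1 (fun x => x.2).
Proof. by exists 0, (0, 1) => x; rewrite /dot /=; ring. Qed.

Lemma hull_P1_ge f vs (m : R) : is_P1 f ->
  (forall v, v \in vs -> m <= f v) -> forall x, hull vs x -> m <= f x.
Proof.
move=> fP1 fm x hx; rewrite -lerN2.
by apply: (hull_P1_le (is_P1N fP1) _ hx) => v /fm; rewrite lerN2.
Qed.

Lemma P1_hull_bounded f vs : is_P1 f ->
  exists m : R, forall x, hull vs x -> `|f x| <= m.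
Proof.
move=> fP1; exists (\sum_(v <- vs) `|f v|) => x hx.
have le v : v \in vs -> `|f v| <= \sum_(u <- vs) `|f u|.
  by move=> vvs; rewrite (big_rem v) //= lerDl sumr_ge0.
rewrite ler_norml; apply/andP; split.
  apply: (hull_P1_ge fP1 _ hx) => v /le; rewrite lerNl; apply: le_trans.
  by rewrite -normrN ler_norm.
apply: (hull_P1_le fP1 _ hx) => v /le; apply: le_trans; exact: ler_norm.
Qed.

Lemma hull_convex vs x y (t : R) : 0 <= t <= 1 -> hull vs x -> hull vs y ->
  hull vs ((1 - t) *: x + t *: y).
Proof.
move=> /andP[t0 t1] [w [w0 w1 ->]] [w' [w0' w1' ->]].
exists (fun i => (1 - t) * w i + t * w' i); split.
- by move=> i; rewrite addr_ge0 // mulr_ge0 // subr_ge0.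
- by rewrite big_split /= -!mulr_sumr w1 w1'; ring.
- rewrite !scaler_sumr -big_split /=; apply: eq_bigr => i _.
  by rewrite !scalerA -scalerDl.
Qed.

Lemma grad_P1 f (c : R) g x : (forall y, f y = c + dot g y) -> grad f x = g.
Proof.
(* With one coordinate frozen, [c + dot g x] has this shape, up to the order of the two products. *)
have aff (p q s t : R) : derive1 (fun z : R => p + (q * z + s)) t = q.
  have -> : (fun z : R => p + (q * z + s)) = cst (p + s) + q *: (id : R -> R).
    by apply/funext => z; rewrite !fctE /= /GRing.scale /=; ring.
  have h : is_derive t (1 : R) (cst (p + s) + q *: (id : R -> R)) (0 + q *: 1).
    exact: is_deriveD.
  by rewrite derive1E derive_val add0r /GRing.scale /= mulr1.
move=> fE; case: g fE => g1 g2 fE; rewrite /grad; congr pair.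
  by rewrite -[RHS](aff c g1 (g2 * x.2) x.1); congr derive1; apply/funext.
rewrite -[RHS](aff c g2 (g1 * x.1) x.2); congr derive1; apply/funext => z.
by rewrite fE /dot /= [_ + g2 * z]addrC.
Qed.

(** * Measurability of triangles and rectangles *)

Lemma measurable_P1 f : is_P1 f -> measurable_fun setT f.
Proof.
move=> [c [g fE]]; rewrite (funext fE).
apply: measurable_funD => //; apply: measurable_funD;
  exact: measurable_funM.
Qed.

Lemma measurable_P1_ge0 f : is_P1 f -> measurable [set x | 0 <= f x].
Proof.
by move=> /measurable_P1 mf; rewrite -[X in measurable X]setTI;
  apply: measurable_fun_le.
Qed.

Lemma ball_planeP x (s : R) y :
  ball x s y <-> `|x.1 - y.1| < s /\ `|x.2 - y.2| < s.
Proof. by []. Qed.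

Definition cross u v : R := u.1 * v.2 - u.2 * v.1.

(** Cramer's rule. The last clause, uniqueness of the coordinates, lets [p] and [q] be read off a
    combination of vertices. *)
Lemma frame_coordinates a u v : cross u v != 0 ->
  exists p q : plane R -> R, [/\ is_P1 p, is_P1 q,
    (forall x, x = a + p x *: u + q x *: v)
  & forall x (s t : R), x = a + s *: u + t *: v -> p x = s /\ q x = t].
Proof.
rewrite /cross => D0; exists (fun x => cross (x - a) v / cross u v).
exists (fun x => cross u (x - a) / cross u v); split.
- exists (- cross a v / cross u v), (v.2 / cross u v, - v.1 / cross u v) => x.
  by rewrite !planeE /cross /dot /=; field.
- exists (- cross u a / cross u v), (- u.2 / cross u v, u.1 / cross u v) => x.
  by rewrite !planeE /cross /dot /=; field.
- by move=> [x1 x2]; rewrite !planeE /cross /=; congr pair; field.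
- by move=> x s t ->; rewrite !planeE /cross /=; split; field.
Qed.

(** In coordinates along two sides, the triangle is the intersection of the half-planes p >= 0, q >=
    0 and p + q <= 1. *)
Lemma measurable_triangle vs : is_triangle vs -> measurable (hull vs).
Proof.
move=> [a [b [c [-> D0]]]].
have [p [q [pP1 qP1 E pqE]]] := frame_coordinates a D0.
have -> : hull [:: a; b; c] =
    [set x | 0 <= p x] `&` [set x | 0 <= q x] `&` [set x | 0 <= 1 - p x - q x].
  apply/seteqP; split => x /=.
    move=> [w [w0]]; rewrite !big_ord_recl !big_ord0 /= /bump /= => w1 xE.
    have wE : w 0%N = 1 - w 1%N - w 2%N by move: w1; lra.
    have /pqE[-> ->] : x = a + w 1%N *: (b - a) + w 2%N *: (c - a).
      by rewrite xE wE !planeE /=; congr pair; ring.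
    by rewrite -wE.
  move=> [[p0 q0] r0].
  (* Barycentric coordinates; the default 0 of [nth] gives nonnegative weights at all further
     indices, as [hull] demands. *)
  exists (fun i => nth 0 [:: 1 - p x - q x; p x; q x] i); split.
  - by case=> [|[|[|i]]] //=; rewrite nth_nil.
  - by rewrite !big_ord_recl !big_ord0 /=; ring.
  - rewrite !big_ord_recl !big_ord0 /= [LHS]E !planeE /=; congr pair; ring.
apply: measurableI; first by apply: measurableI; exact: measurable_P1_ge0.
apply: measurable_P1_ge0.
case: pP1 qP1 => c1 [g1 pE] [c2 [g2 qE]].
exists (1 - c1 - c2), (- g1 - g2) => x.
by rewrite pE qE !planeE /dot /=; ring.
Qed.

Lemma measurable_rectangle vs : is_rectangle vs -> measurable (hull vs).
Proof.
move=> [a [b [c [d [-> cE orth ab ad]]]]].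
have D0 : cross (b - a) (d - a) != 0.
  (* Lagrange's identity: |u|^2 |v|^2 = (u . v)^2 + (u x v)^2 *)
  have dotxx_gt0 x : x != 0 -> 0 < dot x x.
    move=> x0; rewrite lt_neqAle eq_sym.
    rewrite /dot -!expr2 paddr_eq0 ?sqr_ge0 // !sqrf_eq0 addr_ge0 ?sqr_ge0 //.
    by rewrite andbT; apply: contra x0 => /andP[/eqP x1 /eqP x2];
      rewrite -pair_eqE /= x1 x2 !eqxx.
  have : 0 < dot (b - a) (b - a) * dot (d - a) (d - a).
    by rewrite mulr_gt0 // dotxx_gt0 // subr_eq0 eq_sym.
  apply: contraTneq => c0.
  have -> : dot (b - a) (b - a) * dot (d - a) (d - a) =
    dot (b - a) (d - a) ^+ 2 + cross (b - a) (d - a) ^+ 2.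
    by rewrite /dot /cross; ring.
  by rewrite orth c0 expr0n addr0 ltxx.
have [p [q [pP1 qP1 E pqE]]] := frame_coordinates a D0.
have {}cE : c = b + (d - a) by rewrite -cE addrC subrK.
have -> : hull [:: a; b; c; d] =
    [set x | 0 <= p x] `&` [set x | 0 <= 1 - p x] `&`
    ([set x | 0 <= q x] `&` [set x | 0 <= 1 - q x]).
  apply/seteqP; split => x /=.
    move=> [w [w0]]; rewrite !big_ord_recl !big_ord0 /= /bump /= => w1 xE.
    have wE : w 0%N = 1 - w 1%N - w 2%N - w 3%N by move: w1; lra.
    (* As c - a = (b - a) + (d - a), the weight of [c] counts in both coordinates. *)
    have /pqE[-> ->] : x = a + (w 1%N + w 2%N) *: (b - a)
                             + (w 2%N + w 3%N) *: (d - a).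
      by rewrite xE wE cE !planeE /=; congr pair; ring.
    move: (w0 0%N) (w0 1%N) (w0 2%N) (w0 3%N); rewrite wE => *.
    by do !split; lra.
  move=> [[p0 p1] [q0 q1]].
  (* Bilinear weights: products of the one-dimensional weights of the two sides. *)
  exists (fun i => nth 0 [:: (1 - p x) * (1 - q x); p x * (1 - q x);
                             p x * q x; (1 - p x) * q x] i); split.
  - by case=> [|[|[|[|i]]]] //=; rewrite ?nth_nil ?mulr_ge0.
  - by rewrite !big_ord_recl !big_ord0 /=; ring.
  - by rewrite !big_ord_recl !big_ord0 /= [LHS]E cE !planeE /=;
      congr pair; ring.
have P1B h : is_P1 h -> is_P1 (fun x => 1 - h x).
  move=> [k [g hE]]; exists (1 - k), (- g) => x.
  by rewrite hE dotNl opprD addrA.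
by do 2 apply: measurableI; apply: measurable_P1_ge0 => //; exact: P1B.
Qed.

End Plane.

(** * Area of a cell and means of affine functions over it *)

Section Cells.
Context {R : realType} {Omega : set (plane R)} {M : mesh Omega}.
Implicit Types (E : elt M) (x y : plane R) (f : plane R -> R).

Lemma measurable_cell E : measurable (cell E).
Proof.
by have [/measurable_triangle|/measurable_rectangle] := cell_shape E.
Qed.

Lemma area_box (a b c d : R) : a < b -> c < d ->
  (area_measure) (`[a, b] `*` `[c, d]) = ((b - a) * (d - c))%:E.
Proof.
move=> ab cd; rewrite product_measure1E //.
have itv (u v : R) : u < v -> lebesgue_measure `[u, v] = (v - u)%:E.
  by move=> uv; rewrite lebesgue_measure_itv /= lte_fin uv.
by rewrite [X in (X * _)%E]itv // [X in (_ * X)%E]itv.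
Qed.

Lemma cell_area_fin E : (area_measure (cell E) < +oo)%E.
Proof.
have [m1 h1] := P1_hull_bounded (vertices E) is_P1_fst.
have [m2 h2] := P1_hull_bounded (vertices E) is_P1_snd.
(* Half-side of a square containing the cell; the summand 1 makes it positive, as [area_box]
   requires. *)
pose k := `|m1| + `|m2| + 1.
have k0 : - k < k by rewrite /k gtrN // ltr_wpDl // addr_ge0.
apply: (@le_lt_trans _ _ (area_measure (`[- k, k] `*` `[- k, k]))).
  apply: le_measure; rewrite ?inE.
  - exact: measurable_cell.
  - by apply: measurableX.
  - move=> x Ex; have := h1 _ Ex; have := h2 _ Ex.
    have := ler_norm m1; have := ler_norm m2.
    have := normr_ge0 m1; have := normr_ge0 m2.
    rewrite /k => ? ? ? ? x2 x1; split; rewrite /= in_itv /= -ler_norml; lra.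
by rewrite area_box // ltry.
Qed.

(** The disc of radius r contains the concentric square of half-side r/2, because 2 (r/2)^2 <= r^2;
    squares have an explicit product measure. *)
Lemma cell_box E : exists x (s : R), 0 < s /\
  (forall y, `|y.1 - x.1| <= s -> `|y.2 - x.2| <= s -> cell E y).
Proof.
have [x [r [r0 disc _]]] := cell_nondegenerate E.
exists x, (r / 2); split=> [|y y1 y2]; first by rewrite divr_gt0.
apply: disc; rewrite /edisc /= /enorm.
rewrite -[leRHS]gtr0_norm // -sqrtr_sqr ler_wsqrtr // planeE /dot /= -!expr2.
have sq z : `|z| <= r / 2 -> z ^+ 2 <= (r / 2) ^+ 2.
  move=> zr; rewrite -real_normK ?num_real // lerXn2r // nnegrE //.
  by rewrite ltW // divr_gt0.
by have := sq _ y1; have := sq _ y2; nra.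
Qed.

Lemma area_gt0 E : 0 < area E.
Proof.
have [x [s [s0 box]]] := cell_box E.
rewrite /area fine_gt0 // cell_area_fin andbT.
have lt_box z : z - s < z + s by lra.
apply: (@lt_le_trans _ _
  (area_measure (`[x.1 - s, x.1 + s] `*` `[x.2 - s, x.2 + s]))).
  by rewrite area_box // lte_fin mulr_gt0 // subr_gt0.
apply: le_measure; rewrite ?inE.
- exact: measurableX.
- exact: measurable_cell.
- move=> y [/=]; rewrite !in_itv /= => y1 y2.
  by apply: box; rewrite ler_distl.
Qed.

Lemma integrable_P1 E f : is_P1 f ->
  (area_measure).-integrable (cell E) (EFin \o f).
Proof.
move=> fP1; have [m hm] := P1_hull_bounded (vertices E) fP1.
apply: measurable_bounded_integrable.
- exact: measurable_cell.
- exact: cell_area_fin.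
- exact: measurable_funTS (measurable_P1 fP1).
- exists m; split; first exact: num_real.
  by move=> k mk x Ex; apply: (le_trans (hm x Ex)); exact: ltW.
Qed.

(** Linearity of the integral, the centroid being the pair of coordinate means: an affine function
    takes its mean value there. *)
Lemma mean_P1 E (c : R) (g : plane R) :
  mean E (fun x => c + dot g x) = c + dot g (centroid E).
Proof.
have mE := measurable_cell E.
have A0 : area E != 0 by rewrite gt_eqF // area_gt0.
have int := @integrable_P1 E.
rewrite /centroid /mean /int_area /dot /= RintegralD //; last 2 first.
- apply: int; exists c, 0 => x; rewrite /dot /= ; ring.
- by apply: int; exists 0, g => x; rewrite add0r.
rewrite Rintegral_cst // RintegralD //; last 2 first.
- by apply: int; exists 0, (g.1, 0) => x; rewrite /dot /=; ring.
- by apply: int; exists 0, (0, g.2) => x; rewrite /dot /=; ring.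
rewrite !RintegralZl //; [|exact: int is_P1_snd|exact: int is_P1_fst].
by rewrite -[fine _]/(area E); field.
Qed.

Lemma le_mean E f h : is_P1 f -> is_P1 h ->
  (forall x, cell E x -> f x <= h x) -> mean E f <= mean E h.
Proof.
move=> fP1 hP1 fh; rewrite ler_wpM2r // ?invr_ge0 ?(ltW (area_gt0 E)) //.
apply: le_Rintegral => //; [exact: measurable_cell| |]; exact: integrable_P1.
Qed.

Lemma mean_cst E (c : R) : mean E (fun=> c) = c.
Proof.
have -> : (fun=> c) = (fun x : plane R => c + dot 0 x).
  by apply/funext => x; rewrite /dot /=; ring.
by rewrite mean_P1 /dot /=; ring.
Qed.

Lemma is_P1_cst (c : R) : is_P1 (fun _ : plane R => c).
Proof. by exists c, 0 => x; rewrite /dot /=; ring. Qed.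

Lemma mean_itv E f (m k : R) : is_P1 f ->
  (forall x, cell E x -> m <= f x <= k) -> m <= mean E f <= k.
Proof.
move=> fP1 fmk; rewrite -{1}(mean_cst E m) -(mean_cst E k).
by apply/andP; split; apply: le_mean => //; try exact: is_P1_cst;
  move=> x /fmk /andP[].
Qed.

(* A cell is convex with an interior point c, so (1 - t) x + t c is interior for
   every 0 < t <= 1; then let t tend to 0. *)
Lemma interior_cell_itv E f (m k : R) : is_P1 f ->
  (forall x, interior (cell E) x -> m <= f x <= k) ->
  forall x, cell E x -> m <= f x <= k.
Proof.
move=> fP1 fmk x Ex; have [c [s [s0 box]]] := cell_box E.
have seg (t : R) : 0 < t -> t <= 1 -> m <= (1 - t) * f x + t * f c <= k.
  move=> t0 t1; have -> : (1 - t) * f x + t * f c = f ((1 - t) *: x + t *: c).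
    by case: fP1 => c0 [g fE]; rewrite !fE dotDr !dotZr; ring.
  (* The homothety of centre [x] and ratio [t] shrinks the square around [c] to one of half-side
     [t * s], still in the cell by convexity. *)
  apply: fmk; apply/nbhs_ballP; exists (t * s); first by rewrite /= mulr_gt0.
  move=> y /ball_planeP; rewrite !planeE /= => -[y1 y2].
  have -> : y = (1 - t) *: x + t *: (c + t^-1 *: (y - ((1 - t) *: x + t *: c))).
    rewrite !planeE /= [LHS]surjective_pairing; congr pair; field; lra.
  apply: hull_convex => //; first by rewrite ltW.
  have sc z : `|z| < t * s -> `|t^-1 * z| <= s.
    rewrite normrM gtr0_norm ?invr_gt0 // => /ltW.
    by rewrite -ler_pdivrMl ?invr_gt0 // invrK.
  apply: box; rewrite !planeE /= addrAC subrr add0r; apply: sc;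
    by rewrite distrC.
have lim (a b l : R) :
    (forall t, 0 < t -> t <= 1 -> (1 - t) * a + t * b <= l) -> a <= l.
  move=> h; rewrite leNgt; apply/negP => la.
  have bl : b <= l by have := h 1 ltr01 (lexx _); lra.
  (* This value of [t] makes the combination equal to (a + l) / 2 > l; it is at most 1 because b <=
     l. *)
  have t0 : 0 < (a - l) / (2 * (a - b)) by rewrite divr_gt0 //; lra.
  have tE : (a - l) / (2 * (a - b)) * (a - b) = (a - l) / 2 by field; lra.
  by have := h _ t0; rewrite ler_pdivrMr; nra.
apply/andP; split; last first.
  by apply: (lim _ (f c)) => t t0 t1; have /andP[_] := seg t t0 t1.
rewrite -lerN2; apply: (lim _ (- f c)) => t t0 t1.
by have /andP[+ _] := seg t t0 t1; lra.
Qed.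

End Cells.

(** * Bounds on cell averages in the averaging algorithm *)

Section Limiters.
Context {R : realType} {Omega : set (plane R)} {M : mesh Omega}.
Context (D : flow_data M) (tau smin smax : R).
Context (porosity_gt0 : 0 < porosity D) (tau_gt0 : 0 < tau).
Implicit Types (E : elt M) (sbar : elt M -> R) (H : elt M -> edge M -> R).
Implicit Types (S : broken (M := M)).

Lemma Pplus_ge0 H E : 0 <= Pplus tau H E.
Proof.
rewrite mulr_ge0 ?(ltW tau_gt0) //; apply: sumr_ge0 => e _.
by rewrite le_max lexx.
Qed.

Lemma Pminus_le0 H E : Pminus tau H E <= 0.
Proof.
rewrite mulr_ge0_le0 ?(ltW tau_gt0) //; apply: sumr_le0 => e _.
by rewrite ge_min lexx.
Qed.

Section Bounded.
Context (sbar : elt M -> R).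
Context (sbar_itv : forall E, smin <= sbar E <= smax).

Lemma Qplus_ge0 E : 0 <= Qplus D smax sbar E.
Proof.
rewrite /Qplus -mulrBr !mulr_ge0 ?(ltW porosity_gt0) ?(ltW (area_gt0 E)) //.
by rewrite subr_ge0; have /andP[] := sbar_itv E.
Qed.

Lemma Qminus_le0 E : Qminus D smin sbar E <= 0.
Proof.
rewrite /Qminus -mulrBr mulr_ge0_le0 ?(ltW (area_gt0 E)) //.
rewrite mulr_ge0_le0 ?(ltW porosity_gt0) //.
by rewrite subr_le0; have /andP[] := sbar_itv E.
Qed.

Lemma limit_plus_ge0 H E : 0 <= limit_plus D tau smax sbar H E.
Proof. by rewrite le_min ler01 divr_ge0 ?Qplus_ge0 ?Pplus_ge0. Qed.

Lemma limit_minus_ge0 H E : 0 <= limit_minus D tau smin sbar H E.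
Proof.
by rewrite le_min ler01 mulr_le0 ?invr_le0 ?Qminus_le0 ?Pminus_le0.
Qed.

(** The limiter is at most Q^+/P^+; when P^+ = 0 the product vanishes and Q^+ >= 0 suffices. *)
Lemma limit_plus_Pplus H E :
  limit_plus D tau smax sbar H E * Pplus tau H E <= Qplus D smax sbar E.
Proof.
have := Pplus_ge0 H E; rewrite le_eqVlt => /predU1P[<-|P0].
  by rewrite mulr0 Qplus_ge0.
by rewrite -ler_pdivlMr // ge_min lexx orbT.
Qed.

Lemma limit_minus_Pminus H E :
  Qminus D smin sbar E <= limit_minus D tau smin sbar H E * Pminus tau H E.
Proof.
have := Pminus_le0 H E; rewrite le_eqVlt => /predU1P[->|P0].
  by rewrite mulr0 Qminus_le0.
by rewrite -ler_ndivlMr // ge_min lexx orbT.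
Qed.


Lemma alpha_ge0 H E e : 0 <= alpha D tau smin smax sbar H E e.
Proof.
have p0 := limit_plus_ge0 H; have m0 := limit_minus_ge0 H.
rewrite /alpha; case: ifP => _; last case: ifP => _; last exact: ler01;
  by case: (neighbor E e) => [E'|] //; rewrite le_min p0 m0.
Qed.

(** On an interior face the minimum over both sides includes the factor of [E] itself. *)
Lemma alpha_inflow H E e : H E e < 0 ->
  alpha D tau smin smax sbar H E e <= limit_plus D tau smax sbar H E.
Proof.
by rewrite /alpha => ->; case: (neighbor E e) => [E'|] //; rewrite ge_min lexx.
Qed.

Lemma alpha_outflow H E e : 0 < H E e ->
  alpha D tau smin smax sbar H E e <= limit_minus D tau smin sbar H E.
Proof.
move=> H0; rewrite /alpha H0 lt_gtF //.
by case: (neighbor E e) => [E'|] //; rewrite ge_min lexx.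
Qed.

Lemma avg_update_itv H E :
  smin <= (avg_update D tau smin smax (sbar, H)).1 E <= smax.
Proof.
rewrite /=; set F := \sum_(e | _) _.
(* Face by face: an inflow term -alpha H is at most [limit_plus] times -H, and an outflow term is
   nonpositive where max(0, -H) = 0. *)
have Flo : - (tau * F) <= Qplus D smax sbar E.
  apply: le_trans (limit_plus_Pplus H E).
  rewrite /Pplus mulrCA -mulrN ler_wpM2l ?(ltW tau_gt0) //.
  rewrite -sumrN mulr_sumr; apply: ler_sum => e _.
  have := alpha_ge0 H E e; have := @alpha_inflow H E e; case: (ltrP (H E e) 0).
    by move=> H0 /(_ isT) aL _; rewrite max_r; nra.
  by move=> H0 _ a0; rewrite max_l ?oppr_le0 //; nra.
have Fup : Qminus D smin sbar E <= - (tau * F).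
  apply: le_trans (limit_minus_Pminus H E) _.
  rewrite /Pminus mulrCA -mulrN ler_wpM2l ?(ltW tau_gt0) //.
  rewrite -sumrN mulr_sumr; apply: ler_sum => e _.
  have := alpha_ge0 H E e; have := @alpha_outflow H E e; case: (ltrP 0 (H E e)).
    by move=> H0 /(_ isT) aL _; rewrite min_r; nra.
  by move=> H0 _ a0; rewrite min_l ?oppr_ge0 //; nra.
have A0 : 0 < porosity D * area E by rewrite mulr_gt0 ?area_gt0.
(* Over the common denominator phi |E| the update is a mass balance: adding Q^+ or Q^- to phi |E|
   [sbar E] gives exactly phi |E| [smax] or phi |E| [smin]. *)
have -> : sbar E - tau / (porosity D * area E) * F =
    (porosity D * area E * sbar E - tau * F) / (porosity D * area E).
  by field; rewrite !gt_eqF ?area_gt0.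
rewrite ler_pdivlMr // ler_pdivrMr //.
by move: Flo Fup; rewrite /Qplus /Qminus; lra.
Qed.

End Bounded.

Lemma avg_iter_itv sbar0 H0 k : (forall E, smin <= sbar0 E <= smax) ->
  forall E, smin <= (avg_iter D tau smin smax sbar0 H0 k).1 E <= smax.
Proof.
move=> s0; elim: k => [|k IH] E; [exact: s0 | rewrite /avg_iter iterS].
rewrite /avg_iter in IH; case: (iter _ _ _) IH => sbar H IH.
exact: avg_update_itv.
Qed.

(** * Bounds for the slope limiter *)

Section Slope.
Context (S : broken (M := M)) (SP1 : in_D S).
Context (mean_S : forall E, smin <= mean E (S E) <= smax).

(** The minimum starts from the mean on [E], hence lies below it; all competitors are cell means,
    hence at least [smin]. *)
Lemma vmin_itv E v : smin <= vmin S E v <= mean E (S E).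
Proof.
rewrite bigmin_le_id andbT; by apply: le_bigmin => [|E' _];
  [have /andP[] := mean_S E | have /andP[] := mean_S E'].
Qed.

Lemma vmax_itv E v : mean E (S E) <= vmax S E v <= smax.
Proof.
rewrite bigmax_ge_id /=; by apply: bigmax_le => [|E' _];
  [have /andP[] := mean_S E | have /andP[] := mean_S E'].
Qed.

Lemma beta_vertex_ge0 E v : 0 <= beta_vertex S E v.
Proof.
have /andP[_ vm] := vmin_itv E v; have /andP[mv _] := vmax_itv E v.
rewrite /beta_vertex; case: ifP => [vS|_]; last case: ifP => [Sv|_] //.
  by rewrite divr_ge0 // subr_ge0 // (le_trans mv) // ltW.
by rewrite mulr_le0 ?invr_le0 // subr_le0 // (le_trans _ vm) // ltW.
Qed.

Lemma beta_ge0 E : 0 <= beta S E.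
Proof. by apply: le_bigmin => [|v _]; exact: beta_vertex_ge0. Qed.

Lemma beta_le_vertex E v : v \in vertices E -> beta S E <= beta_vertex S E v.
Proof. by move=> vE; apply: ge_bigmin_seq. Qed.

Lemma slope_vertex_itv E v : v \in vertices E ->
  smin <= mean E (S E) + beta S E * (S E v - mean E (S E)) <= smax.
Proof.
move=> /beta_le_vertex; have := beta_ge0 E; move: (beta S E) => b b0.
have /andP[sv vm] := vmin_itv E v; have /andP[mv vs] := vmax_itv E v.
(* Clearing denominators bounds b (S v - mean) by vmax - mean above, or by vmin - mean below; in the
   last case b <= 1 puts the value between the mean and S v. *)
rewrite /beta_vertex; case: ltrP => [vS|Sv]; last case: ltrP => [Sv'|vS].
- rewrite ler_pdivlMr ?subr_gt0 ?(le_lt_trans mv) // => h.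
  by apply/andP; split; nra.
- rewrite ler_ndivlMr ?subr_lt0 ?(lt_le_trans Sv') // => h.
  by apply/andP; split; nra.
- by move=> b1; apply/andP; split; nra.
Qed.

(** For affine S the mean is the value at the centroid, so grad S . (x - centroid) is S x - mean. *)
Lemma slope_limited_marked E : marked smin smax S E ->
  slope_limited smin smax S E =
    fun x => mean E (S E) + beta S E * (S E x - mean E (S E)).
Proof.
move=> mk; apply/funext => x; rewrite /slope_limited (asboolT mk).
have [c [g SE]] := SP1 E.
have mE : mean E (S E) = c + dot g (centroid E) by rewrite (funext SE) mean_P1.
by rewrite (grad_P1 x SE) dotBr SE mE; ring.
Qed.

(** Affinity reduces the bounds on a cell to its vertices and is carried to the next time step. *)
Lemma slope_limited_P1 E : is_P1 (slope_limited smin smax S E).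
Proof.
have [mk|nmk] := pselect (marked smin smax S E).
  rewrite slope_limited_marked //; have [c [g SE]] := SP1 E.
  exists (mean E (S E) + beta S E * (c - mean E (S E))), (beta S E *: g) => x.
  by rewrite SE dotZl; ring.
suff -> : slope_limited smin smax S E = S E by exact: SP1.
by apply/funext => x; rewrite /slope_limited asboolF.
Qed.

Lemma slope_limited_itv E x : cell E x ->
  smin <= slope_limited smin smax S E x <= smax.
Proof.
move=> Ex; have [mk|nmk] := pselect (marked smin smax S E).
  have P1 := slope_limited_P1 E.
  have itv v : v \in vertices E ->
      smin <= slope_limited smin smax S E v <= smax.
    by rewrite slope_limited_marked //; exact: slope_vertex_itv.
  apply/andP; split.
    by apply: (hull_P1_ge P1 _ Ex) => v /itv /andP[].
  by apply: (hull_P1_le P1 _ Ex) => v /itv /andP[].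
rewrite /slope_limited asboolF //; apply/andP; split; rewrite leNgt;
  by apply/negP => Sx; apply: nmk; exists x; rewrite // Sx ?orbT.
Qed.

End Slope.

(** * Affinity and mean of the flux-limited function *)

Lemma flux_limited_P1 S sbar E : in_D S -> is_P1 (flux_limited S sbar E).
Proof.
move=> /(_ E)[c [g SE]]; exists (c - mean E (S E) + sbar E), g => x.
by rewrite /flux_limited SE; ring.
Qed.

Lemma mean_flux_limited S sbar E : in_D S ->
  mean E (flux_limited S sbar E) = sbar E.
Proof.
move=> /(_ E)[c [g SE]]; rewrite /flux_limited; set m := mean E (S E).
have -> : (fun x => S E x - m + sbar E) = (fun x => (c - m + sbar E) + dot g x).
  by apply/funext => x; rewrite SE; ring.
by rewrite mean_P1 /m (funext SE) mean_P1; ring.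
Qed.

End Limiters.

Theorem proposition3p1 (R : realType) (Omega : set (plane R)) (M : mesh Omega)
    (D : flow_data M) (T : R) (N : nat) (smin smax eps1 eps2 : R)
    (s0 : plane R -> R) (P S : nat -> elt M -> plane R -> R)
    (porosity_gt0 : 0 < porosity D)
    (visc_w_gt0 : 0 < visc_w D) (visc_l_gt0 : 0 < visc_l D)
    (sigma_gt0 : 0 < sigma D)
    (T_gt0 : 0 < T) (N_gt0 : (0 < N)%N)
    (eps1_gt0 : 0 < eps1) (eps2_gt0 : 0 < eps2)
    (smin_ge0 : 0 <= smin) (smin_le_smax : smin <= smax) (smax_le1 : smax <= 1)
    (method : DG_FL_SL D (T / N%:R) N smin smax eps1 eps2 s0 P S)
    (S0_bounded : forall x, Omega x -> forall E, cell E x ->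
      smin <= S 0%N E x <= smax) :
  forall n : nat, (n < N)%N -> forall x, Omega x -> forall E, cell E x ->
    smin <= S n.+1 E x <= smax.
Proof.
case: method => _ [_ _ S0_P1 _] step.
have tau_gt0 : 0 < T / N%:R by rewrite divr_gt0 // ltr0n.
(* The invariant includes affinity and covers whole closed cells, over which the next step takes its
   means. *)
have inv n : (n <= N)%N ->
    in_D (S n) /\ forall E x, cell E x -> smin <= S n E x <= smax.
  elim: n => [_|n IH nN].
    (* The initial bound is given at points of [Omega], while a closed cell may reach its boundary;
       the cell interior lies in [Omega], and affinity extends the bound. *)
    split=> // E; apply: interior_cell_itv => // x Ex.
    by apply: S0_bounded; [exact: cell_sub Ex | exact: interior_subset].
  have [SP1 S_itv] := IH (ltnW nN).
  have [St [sbar [[_ StP1 _ _] [k [_ _ _ sbarE]] SE]]] := step n nN.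
  have sbar_itv E : smin <= sbar E <= smax.
    rewrite sbarE; apply: avg_iter_itv => // E'.
    exact: mean_itv (SP1 E') (S_itv E').
  have FLP1 : in_D (flux_limited St sbar).
    by move=> E; exact: flux_limited_P1.
  have mean_itv E : smin <= mean E (flux_limited St sbar E) <= smax.
    by rewrite mean_flux_limited.
  split=> [E|E x Ex].
    by rewrite (funext (SE E)); exact: slope_limited_P1.
  by rewrite SE; exact: slope_limited_itv.
by move=> n nN x _ E Ex; apply: (inv n.+1 nN).2.
Qed.
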